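(* Let $d>2$ be an integer and $\zeta=\exp(\pi i/d)$. Let $\tilde S_{0,1}$ be the renormalized crossed $S$-matrix of $\mathcal{C}=\mathcal{C}_d\boxtimes\mathcal{C}_d^{\mathrm{rev}}$ (with its $\mathbb{Z}/2\mathbb{Z}$-grading) defined in the context. Then $\tilde S_{0,1}$ is the Fourier matrix associated with the non-trivial family of ''unipotent characters'' of the dihedral group with non-trivial automorphism: for all $(i,j)\in I$ and $(k,l)\in J$, $$(\tilde{S}_{0,1})_{\Psi_0((i,j)),\Psi_1((k,l))}=\langle(i,j),(k,l)\rangle .$$ Moreover, the inverse of the eigenvalue of the Frobenius is given by the square of the twist on $\mathcal{C}_1$: for all $(k,l)\in J$, $$\theta_{\Psi_{1}((k,l))}^{-2}=\zeta^{kl}.$$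
   Context: Everything is over $\mathbb{C}$. Twisted dihedral datum. $I$ is the set of pairs of integers $(i,j)$ with $0<i<j<i+j<d$ or $0=i<j<d/2$. $J$ is the set of pairs $(k,l)$ of odd integers with $0<k<l<k+l<2d$. The Fourier matrix is given by $\langle(i,j),(k,l)\rangle=\frac{1}{d}(\zeta^{il+jk}+\zeta^{-il-jk}-\zeta^{ik+jl}-\zeta^{-ik-jl})$ for $(i,j)\in I$, $(k,l)\in J$, and the eigenvalue of the Frobenius attached to $(k,l)\in J$ is $\zeta^{kl}$. Category. $\mathcal{C}_d$ is the modular (spherical, braided, non-degenerate) fusion category obtained as the semisimple quotient of the category of tilting modules of $\mathcal{U}_\zeta(\mathfrak{sl}_2)$; its simple objects are $V_1=\mathbf 1,V_2,\dots,V_{d-1}$, all self-dual, with truncated Clebsch–Gordan fusion rules, $S_{V_i,V_j}=\frac{\zeta^{ij}-\zeta^{-ij}}{\zeta-\zeta^{-1}}$ and twist $\theta_{V_i}=\zeta^{(i^2-1)/2}$; moreover $V_{d-1}\otimes V_i\simeq V_{d-i}$. $\mathcal{C}_d^{\mathrm{rev}}$ is the same category with reversed braiding. Hence in $\mathcal{C}$, $S_{V_i\boxtimes V_j,V_k\boxtimes V_l}=\frac{\zeta^{ik}-\zeta^{-ik}}{\zeta-\zeta^{-1}}\frac{\zeta^{jl}-\zeta^{-jl}}{\zeta-\zeta^{-1}}$ and $\theta_{V_i\boxtimes V_j}=\zeta^{(i^2-j^2)/2}$. The object $\varepsilon=V_{d-1}\boxtimes V_{d-1}$ generates a subcategory equivalent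 to $\mathrm{Rep}(\mathbb{Z}/2\mathbb{Z})$ and $\mathcal{C}$ is graded by $\mathbb{Z}/2\mathbb{Z}$: the double braiding of $\varepsilon$ with a simple object is $\mathrm{id}$ in degree $0$ and $-\mathrm{id}$ in degree $1$. So $\mathcal{C}_0$ (resp. $\mathcal{C}_1$) has simple objects $V_i\boxtimes V_j$ with $i\equiv j$ (resp. $i\not\equiv j$) mod $2$. Crossed matrix. $\tilde I$ is the set of pairs $(i,j)$ with $i\equiv j$ mod $2$ and $0<i<j<d$ or $0<i=j<d/2$ (it indexes representatives $V_i\boxtimes V_j$ of the free orbits of $\varepsilon\otimes-$ on $\mathrm{Irr}(\mathcal{C}_0)$); $\tilde J$ is the set of pairs $(k,l)$ with $0<k<l<d$ and $k\not\equiv l$ mod $2$ (it indexes representatives of the orbits on $\mathrm{Irr}(\mathcal{C}_1)$). $S_{0,1}=(S_{V_i\boxtimes V_j,V_k\boxtimes V_l})_{(i,j)\in\tilde I,(k,l)\in\tilde J}$ and $\tilde S_{0,1}$ is $S_{0,1}$ divided by the positive square root $-d/(\zeta-\zeta^{-1})^2$ of $\frac12\dim(\mathcal{C}_0)$, where $\dim(\mathcal{C}_0)=\sum_{X\in\mathrm{Irr}(\mathcal{C}_0)}\dim(X)^2$. For $(k,l)\in\tilde J$, $\theta_{(k,l)}:=\theta_{V_k\boxtimes V_l}$. Bijections: $\Psi_0\colon I\to\tilde I$, $(i,j)\mapsto(j-i,i+j)$; $\Psi_1\colon J\to\tilde J$, $(k,l)\mapsto\left(\frac{l-k}{2},\frac{k+l}{2}\right)$.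 *)

(* Defs.v *)
From HB Require Import structures.
From mathcomp Require Import all_boot all_order all_algebra.
From mathcomp Require Import reals trigo.
From mathcomp Require Import complex.
From mathcomp Require Import zify ring.

Set Implicit Arguments.
Unset Strict Implicit.
Unset Printing Implicit Defensive.

Import Order.TTheory GRing.Theory Num.Theory.
Local Open Scope ring_scope.
Local Open Scope complex_scope.

(* exp(i x) *)
Definition expi (R : realType) (x : R) : R[i] := cos x +i* sin x.

Definition zeta (R : realType) (d : nat) : R[i] := expi (pi / d%:R : R).

(* exp(pi i / 2d), the square root of zeta giving a meaning to the
   half-integral powers of zeta in the twists *)
Definition zeta_half (R : realType) (d : nat) : R[i] :=
  expi (pi / (2 * d)%N%:R : R).

(* The numerical invariants of a spherical braided fusion category: its
   isomorphism classes of simple objects, the unit and the duality on them, the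
   unnormalised S-matrix (traces of the double braidings) and the twists.  This
   is a carrier of data only, no axioms are imposed. *)
Record modular_data (K : fieldType) := ModularData {
  irr : finType;
  one_obj : irr;
  dual_obj : irr -> irr;
  Smat : irr -> irr -> K;
  twist : irr -> K }.

Arguments one_obj {K} M : rename.
Arguments dual_obj {K} M X : rename.
Arguments Smat {K} M X Y : rename.
Arguments twist {K} M X : rename.

Definition dim_obj (K : fieldType) (M : modular_data K) (X : irr M) : K :=
  Smat M (one_obj M) X.

(* The trace of the inverse of the double braiding of X and Y is the entry of
   the S-matrix at X and the dual of Y. *)
Definition rev_data (K : fieldType) (M : modular_data K) : modular_data K :=
  @ModularData K (irr M) (one_obj M) (dual_obj M)
    (fun X Y => Smat M X (dual_obj M Y))
    (fun X => (twist M X)^-1).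

Definition deligne_data (K : fieldType) (M N : modular_data K) :
    modular_data K :=
  @ModularData K (irr M * irr N)%type (one_obj M, one_obj N)
    (fun X => (dual_obj M X.1, dual_obj N X.2))
    (fun X Y => Smat M X.1 Y.1 * Smat N X.2 Y.2)
    (fun X => twist M X.1 * twist N X.2).

(* For g invertible and X simple, g (x) X is simple of dimension
   dim g * dim X, so the double braiding of g and X is this scalar. *)
Definition double_braiding (K : fieldType) (M : modular_data K)
    (g X : irr M) : K :=
  Smat M g X / (dim_obj g * dim_obj X).

(* V_i is the element of value i *)
Definition irr_sl2 (d : nat) : finType := {i : 'I_d | (0 < i)%N}.

Definition idx (d : nat) (X : irr_sl2 d) : nat := val (val X).

Definition V (d i : nat) (hi : (0 < i < d)%N) : irr_sl2 d :=
  exist _ (Ordinal (proj2 (andP hi))) (proj1 (andP hi)).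

Lemma one_lt (d : nat) : (2 < d)%N -> (0 < 1 < d)%N.
Proof. lia. Qed.

Lemma pred_lt (d : nat) : (2 < d)%N -> (0 < d.-1 < d)%N.
Proof. lia. Qed.

(* theta_(V_i) = zeta^((i^2-1)/2), with i > 0 *)
Definition C_sl2 (R : realType) (d : nat) (hd : (2 < d)%N) :
    modular_data R[i] :=
  let z := zeta R d in
  @ModularData R[i] (irr_sl2 d) (V (one_lt hd)) id
    (fun X Y => (z ^+ (idx X * idx Y) - z ^- (idx X * idx Y)) / (z - z^-1))
    (fun X => zeta_half R d ^+ ((idx X) ^ 2 - 1)%N).

Definition CC (R : realType) (d : nat) (hd : (2 < d)%N) : modular_data R[i] :=
  deligne_data (C_sl2 R hd) (rev_data (C_sl2 R hd)).

Definition eps (R : realType) (d : nat) (hd : (2 < d)%N) : irr (CC R hd) :=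
  (V (pred_lt hd), V (pred_lt hd)).

Definition deg0 (R : realType) (d : nat) (hd : (2 < d)%N) :
    pred (irr (CC R hd)) :=
  fun X => double_braiding (eps R hd) X == 1.

Definition deg1 (R : realType) (d : nat) (hd : (2 < d)%N) :
    pred (irr (CC R hd)) :=
  fun X => double_braiding (eps R hd) X == -1.

Lemma expiD (R : realType) (x y : R) : expi (x + y) = expi x * expi y.
Proof. by rewrite /expi cosD sinD; simpc; congr (_ +i* _); rewrite addrC. Qed.

Lemma expiMn (R : realType) (x : R) (n : nat) : expi x ^+ n = expi (n%:R * x).
Proof.
elim: n => [|n IH]; first by rewrite expr0 mul0r /expi cos0 sin0.
by rewrite exprS IH -expiD -natr1 mulrDl mul1r addrC.
Qed.

Lemma expiV (R : realType) (x : R) : (expi x)^-1 = expi (- x).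
Proof.
have h : expi x * expi (- x) = 1.
  by rewrite -expiD subrr /expi cos0 sin0.
have nz : expi x != 0.
  by apply/eqP => e; move: h; rewrite e mul0r => /esym/eqP; rewrite oner_eq0.
by apply: (mulfI nz); rewrite h mulfV.
Qed.

Lemma zetaXd (R : realType) (d : nat) : (2 < d)%N -> zeta R d ^+ d = -1.
Proof.
move=> hd; rewrite /zeta expiMn mulrC divfK ?pnatr_eq0; last by lia.
by rewrite /expi cospi sinpi; apply/eqP; rewrite eq_complex /= oppr0 !eqxx.
Qed.

Lemma zeta_neq0 (R : realType) (d : nat) : (2 < d)%N -> zeta R d != 0.
Proof.
move=> hd; apply/eqP => h; have := zetaXd R hd.
rewrite h expr0n; case: d hd {h} => // d _ /= /esym/eqP.
by rewrite oppr_eq0 oner_eq0.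
Qed.

Lemma zetaB_neq0 (R : realType) (d a : nat) : (0 < a < d)%N ->
  zeta R d ^+ a - zeta R d ^- a != 0.
Proof.
move=> /andP[a0 ad]; rewrite /zeta expiMn expiV /expi cosN sinN.
set t := a%:R * _; have st : 0 < sin t.
  have d0 : 0 < d%:R :> R by rewrite ltr0n; lia.
  apply: sin_gt0_pi; apply/andP; split.
    by rewrite mulr_gt0 ?ltr0n // divr_gt0 ?pi_gt0.
  by rewrite /t mulrA ltr_pdivrMr // mulrC ltr_pM2l ?pi_gt0 // ltr_nat.
apply/eqP => /(congr1 (@complex.Im R)) /=; rewrite opprK => /eqP.
by apply/negP; apply: lt0r_neq0; rewrite addr_gt0.
Qed.

Lemma zetaB_pred (R : realType) (d a : nat) : (2 < d)%N ->
  zeta R d ^+ (d.-1 * a) - zeta R d ^- (d.-1 * a)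
  = (-1) ^+ a.+1 * (zeta R d ^+ a - zeta R d ^- a).
Proof.
move=> hd; have z0 := zeta_neq0 R hd.
have za : zeta R d ^+ a != 0 by rewrite expf_neq0.
have e : zeta R d ^+ (d.-1 * a) = (-1) ^+ a / zeta R d ^+ a.
  apply: (mulIf za); rewrite divfK // -exprD -(zetaXd R hd) -exprM.
  by congr (_ ^+ _); rewrite -{2}(mul1n a) -mulnDl; congr muln; lia.
rewrite e invfM invrK -signr_odd exprS -[(-1) ^+ a]signr_odd.
by case: (odd a); rewrite ?expr0 ?expr1 ?invrN1 ?invr1; ring.
Qed.

Lemma double_braiding_eps (R : realType) (d : nat) (hd : (2 < d)%N)
    (X : irr (CC R hd)) :
  double_braiding (eps R hd) X = (-1) ^+ (idx X.1 + idx X.2).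
Proof.
case: X => x y; rewrite /double_braiding /dim_obj /=.
have -> : idx (V (pred_lt hd)) = d.-1 by [].
have -> : idx (V (one_lt hd)) = 1%N by [].
have h1 : zeta R d ^+ 1 - zeta R d ^- 1 != 0 by apply: zetaB_neq0; lia.
have hx : zeta R d ^+ idx x - zeta R d ^- idx x != 0.
  by apply: zetaB_neq0; rewrite /idx (valP x) (valP (val x)).
have hy : zeta R d ^+ idx y - zeta R d ^- idx y != 0.
  by apply: zetaB_neq0; rewrite /idx (valP y) (valP (val y)).
have p1 : zeta R d ^+ d.-1 - zeta R d ^- d.-1 = zeta R d - (zeta R d)^-1.
  by have := zetaB_pred R 1 hd; rewrite muln1 expr1 sqrrN expr1n mul1r.
rewrite !mul1n p1 !zetaB_pred // exprD !(exprS (-1)).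
have field_id (F : fieldType) (u v w p q : F) :
    u != 0 -> v != 0 -> w != 0 ->
    -1 * p * v / u * (-1 * q * w / u) / (u / u * (u / u) * (v / u * (w / u)))
    = p * q.
  by move=> u0 v0 w0; field; rewrite u0 v0 w0.
exact: field_id h1 hx hy.
Qed.

Lemma deg0E (R : realType) (d : nat) (hd : (2 < d)%N) (X : irr (CC R hd)) :
  deg0 X = (idx X.1 == idx X.2 %[mod 2]).
Proof.
rewrite /deg0 double_braiding_eps -signr_odd.
have -> : (idx X.1 == idx X.2 %[mod 2])%N = ~~ odd (idx X.1 + idx X.2) by lia.
case: odd => /=; rewrite ?expr0 ?expr1 ?eqxx //.
by apply/negbTE; rewrite lt_eqF // (lt_trans (y := 0)) ?ltr01 ?oppr_lt0 ?ltr01.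
Qed.

Lemma deg1E (R : realType) (d : nat) (hd : (2 < d)%N) (X : irr (CC R hd)) :
  deg1 X = (idx X.1 != idx X.2 %[mod 2]).
Proof.
rewrite /deg1 double_braiding_eps -signr_odd.
have -> : (idx X.1 != idx X.2 %[mod 2])%N = odd (idx X.1 + idx X.2) by lia.
case: odd => /=; rewrite ?expr0 ?expr1 ?eqxx //.
by apply/negbTE; rewrite gt_eqF // (lt_trans (y := 0)) ?ltr01 ?oppr_lt0 ?ltr01.
Qed.

Definition dimC0 (R : realType) (d : nat) (hd : (2 < d)%N) : R[i] :=
  \sum_(X : irr (CC R hd) | deg0 X) dim_obj X ^+ 2.

Definition in_tI (i j : nat) (d : nat) : bool :=
  ((i == j %[mod 2])
   && ([&& 0 < i, i < j & j < d] || [&& 0 < i, i == j & 2 * j < d]))%N.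

Definition in_tJ (k l : nat) (d : nat) : bool :=
  [&& 0 < k, k < l, l < d & k != l %[mod 2]]%N.

Definition tI (d : nat) : finType :=
  {X : irr_sl2 d * irr_sl2 d | in_tI (idx X.1) (idx X.2) d}.

Definition tJ (d : nat) : finType :=
  {X : irr_sl2 d * irr_sl2 d | in_tJ (idx X.1) (idx X.2) d}.

Lemma tI_deg0 (R : realType) (d : nat) (hd : (2 < d)%N) (X : tI d) :
  @deg0 R d hd (val X).
Proof. by rewrite deg0E; case/andP: (valP X). Qed.

Lemma tJ_deg1 (R : realType) (d : nat) (hd : (2 < d)%N) (Y : tJ d) :
  @deg1 R d hd (val Y).
Proof. by rewrite deg1E; case/and4P: (valP Y). Qed.

Definition S01 (R : realType) (d : nat) (hd : (2 < d)%N) (X : tI d) (Y : tJ d)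
    : R[i] :=
  Smat (CC R hd) (val X) (val Y).

(* sqrtC is the nonnegative square root on nonnegative numbers; here its value
   is -d / (zeta - zeta^-1)^2. *)
Definition tS01 (R : realType) (d : nat) (hd : (2 < d)%N) (X : tI d) (Y : tJ d)
    : R[i] :=
  S01 R hd X Y / sqrtC (dimC0 R hd / 2%:R).

Definition in_I (i j d : nat) : bool :=
  ([&& 0 < i, i < j, j < i + j & i + j < d]
   || [&& i == 0, 0 < j & 2 * j < d])%N.

Definition in_J (k l d : nat) : bool :=
  [&& odd k, odd l, 0 < k, k < l, l < k + l & k + l < 2 * d]%N.

Definition idxI (d : nat) : finType :=
  {p : 'I_d * 'I_d | in_I p.1 p.2 d}.

Definition idxJ (d : nat) : finType :=
  {p : 'I_(2 * d) * 'I_(2 * d) | in_J p.1 p.2 d}.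

Definition fourier (R : realType) (d : nat) (p : idxI d) (q : idxJ d) : R[i] :=
  let z := zeta R d in
  let i : nat := (val p).1 in let j : nat := (val p).2 in
  let k : nat := (val q).1 in let l : nat := (val q).2 in
  d%:R^-1 * (z ^+ (i * l + j * k) + z ^- (i * l + j * k)
             - z ^+ (i * k + j * l) - z ^- (i * k + j * l)).

Definition frobenius (R : realType) (d : nat) (q : idxJ d) : R[i] :=
  let k : nat := (val q).1 in let l : nat := (val q).2 in
  zeta R d ^+ (k * l).

Lemma Psi0_lt1 (d i j : nat) : in_I i j d -> (0 < j - i < d)%N.
Proof. by rewrite /in_I; lia. Qed.

Lemma Psi0_lt2 (d i j : nat) : in_I i j d -> (0 < i + j < d)%N.
Proof. by rewrite /in_I; lia. Qed.

Lemma Psi0_in (d i j : nat) : in_I i j d -> in_tI (j - i) (i + j) d.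
Proof. by rewrite /in_I /in_tI; lia. Qed.

Lemma Psi1_lt1 (d k l : nat) : in_J k l d -> (0 < (l - k)./2 < d)%N.
Proof. by rewrite /in_J; lia. Qed.

Lemma Psi1_lt2 (d k l : nat) : in_J k l d -> (0 < (k + l)./2 < d)%N.
Proof. by rewrite /in_J; lia. Qed.

Lemma Psi1_in (d k l : nat) : in_J k l d -> in_tJ (l - k)./2 (k + l)./2 d.
Proof. by rewrite /in_J /in_tJ; lia. Qed.

Definition Psi0 (d : nat) (p : idxI d) : tI d :=
  exist (fun X : irr_sl2 d * irr_sl2 d => in_tI (idx X.1) (idx X.2) d)
    (V (Psi0_lt1 (valP p)), V (Psi0_lt2 (valP p))) (Psi0_in (valP p)).

Definition Psi1 (d : nat) (q : idxJ d) : tJ d :=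
  exist (fun X : irr_sl2 d * irr_sl2 d => in_tJ (idx X.1) (idx X.2) d)
    (V (Psi1_lt1 (valP q)), V (Psi1_lt2 (valP q))) (Psi1_in (valP q)).

Lemma idx_inj (d : nat) : injective (@idx d).
Proof. by move=> x y h; apply/val_inj/val_inj. Qed.

Lemma Psi0_bij (d : nat) : bijective (@Psi0 d).
Proof.
apply: inj_card_bij.
  move=> [[i j] /= hp] [[i' j'] /= hq] /(congr1 val) [h1 h2].
  apply/val_inj => /=; move: (hp) (hq); rewrite /= /in_I => h3 h4.
  by congr (_, _); apply/val_inj => /=; lia.
apply: (@leq_trans #|[set Psi0 p | p : idxI d]|); last exact: leq_imset_card.
apply/subset_leq_card/subsetP => -[[x y] hX] _; apply/imsetP.
have := valP (val x); have := valP (val y); have := valP x; have := valP y.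
move: (hX); rewrite /= /in_tI /idx /= => h hy hx ly lx.
have hi : ((idx y - idx x)./2 < d)%N by rewrite /idx /=; lia.
have hj : ((idx x + idx y)./2 < d)%N by rewrite /idx /=; lia.
have hI : in_I (Ordinal hi, Ordinal hj).1 (Ordinal hi, Ordinal hj).2 d.
  by rewrite /in_I /= /idx /=; lia.
exists (exist (fun p : 'I_d * 'I_d => in_I p.1 p.2 d) _ hI) => //.
by apply/val_inj; congr (_, _); apply/idx_inj; rewrite /idx /= /idx /=; lia.
Qed.

Lemma Psi1_bij (d : nat) : bijective (@Psi1 d).
Proof.
apply: inj_card_bij.
  move=> [[i j] /= hp] [[i' j'] /= hq] /(congr1 val) [h1 h2].
  apply/val_inj => /=; move: (hp) (hq); rewrite /= /in_J => h3 h4.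
  by congr (_, _); apply/val_inj => /=; lia.
apply: (@leq_trans #|[set Psi1 p | p : idxJ d]|); last exact: leq_imset_card.
apply/subset_leq_card/subsetP => -[[x y] hX] _; apply/imsetP.
have := valP (val x); have := valP (val y); have := valP x; have := valP y.
move: (hX); rewrite /= /in_tJ /idx /= => h hy hx ly lx.
have hi : ((idx y - idx x) < 2 * d)%N by rewrite /idx /=; lia.
have hj : ((idx x + idx y) < 2 * d)%N by rewrite /idx /=; lia.
have hI : in_J (Ordinal hi, Ordinal hj).1 (Ordinal hi, Ordinal hj).2 d.
  by rewrite /in_J /= /idx /=; lia.
exists (exist (fun p : 'I_(2 * d) * 'I_(2 * d) => in_J p.1 p.2 d) _ hI) => //.
by apply/val_inj; congr (_, _); apply/idx_inj; rewrite /idx /= /idx /=; lia.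
Qed.

(* Main.v *)
(** Write [dim V_i = [i]].  The indicator of [i = j mod 2] is [(1 + (-1)^(i+j))/2],
    so [2 dim C_0 = A^2 + B^2] with [A = \sum_i [i]^2] and
    [B = \sum_i (-1)^i [i]^2].  Summing geometric progressions in [zeta^2] and
    [-zeta^2] gives [A = -2d/(zeta - zeta^-1)^2] and [B = 0], where [d > 2]
    guarantees [zeta^2 <> -1].  The Fourier matrix then appears by expanding the
    product of the two factors of [S], because [Psi_0(i,j) = (a,b)] and
    [Psi_1(k,l) = (m,n)] satisfy [am + bn = ik + jl] and [bn - am = il + jk]. *)
Require Import Defs.
From mathcomp Require Import all_boot all_order all_algebra.
From mathcomp Require Import reals trigo complex.
From mathcomp Require Import zify ring.

Set Implicit Arguments.
Unset Strict Implicit.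
Unset Printing Implicit Defensive.

Import GRing.Theory Num.Theory.
Local Open Scope ring_scope.

(* The denominators [w z^2 - 1] and [w z^-2 - 1] of the two geometric series are
   cleared. *)
Lemma sum_signed_qsquare (F : fieldType) (z : F) (d : nat) (w : F) :
  z != 0 -> z ^+ d ^+ 2 = 1 ->
  (w * z ^+ 2 - 1) * (w - z ^+ 2) *
    (\sum_(i < d) w ^+ i * (z ^+ i - z ^- i) ^+ 2 + 2 * \sum_(i < d) w ^+ i)
  = (w ^+ d - 1) * (w - z ^+ 2 + z ^+ 2 * (w * z ^+ 2 - 1)).
Proof.
move=> z0 zd.
have e1 : (w * z ^+ 2 - 1) * \sum_(i < d) (w * z ^+ 2) ^+ i = w ^+ d - 1.
  by rewrite -subrX1 exprMn -exprM mulnC exprM zd mulr1.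
have e2 : (w - z ^+ 2) * \sum_(i < d) (w / z ^+ 2) ^+ i
          = z ^+ 2 * (w ^+ d - 1).
  have -> : w - z ^+ 2 = z ^+ 2 * (w / z ^+ 2 - 1) by field.
  by rewrite -mulrA -subrX1 expr_div_n -exprM mulnC exprM zd divr1.
have -> : \sum_(i < d) w ^+ i * (z ^+ i - z ^- i) ^+ 2
            + 2 * \sum_(i < d) w ^+ i
    = \sum_(i < d) (w * z ^+ 2) ^+ i + \sum_(i < d) (w / z ^+ 2) ^+ i.
  rewrite mulr_sumr -!big_split /=; apply: eq_bigr => i _.
  rewrite expr_div_n exprMn -!exprM mulnC !exprM.
  by field; rewrite expf_neq0.
by rewrite mulrDr mulrAC e1 -mulrA e2; ring.
Qed.

Lemma zeta_sqr_neq1 (R : realType) (d : nat) : (2 < d)%N ->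
  zeta R d ^+ 2 != 1.
Proof.
move=> hd; have z0 := zeta_neq0 R hd.
apply/eqP => h; have /eqP[] := @zetaB_neq0 R d 1 ltac:(lia).
by rewrite expr1; apply: (mulfI z0); rewrite mulrBr mulfV // -expr2 h mulr0 subrr.
Qed.

(** If [zeta^2 = -1], then [zeta^2] equals its own inverse, against [zetaB_neq0] at [a = 2 < d]. *)
Lemma zeta_sqr_neqN1 (R : realType) (d : nat) : (2 < d)%N ->
  zeta R d ^+ 2 != -1.
Proof.
move=> hd; apply/eqP => h; have /eqP[] := @zetaB_neq0 R d 2 ltac:(lia).
by rewrite h invrN1 subrr.
Qed.

(** At [w = 1] the right side of [sum_signed_qsquare] vanishes while its prefactor [-(z^2 - 1)^2]
    does not, so the sum cancels [2 * \sum_(i < d) 1 = 2d]. *)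
Lemma sum_qsquare (R : realType) (d : nat) : (2 < d)%N ->
  \sum_(i < d) (zeta R d ^+ i - zeta R d ^- i) ^+ 2 = - (2 * d)%:R.
Proof.
move=> hd; have z0 := zeta_neq0 R hd.
have := @sum_signed_qsquare _ (zeta R d) d 1 z0.
rewrite (zetaXd R hd) sqrrN !expr1n => /(_ erefl).
rewrite subrr mul0r => /eqP; rewrite !mulf_eq0 mul1r.
rewrite ![_ - _ == 0]subr_eq0 [1 == _]eq_sym (negPf (zeta_sqr_neq1 R hd)) /=.
under [X in 2 * X]eq_bigr do rewrite expr1n.
under eq_bigr do rewrite expr1n mul1r.
by rewrite sumr_const card_ord addr_eq0 natrM => /eqP.
Qed.

(** At [w = -1] the prefactor is [(1 + z^2)^2]. Writing [(-1)^d - 1 = -2X] with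
    [X = \sum_(i < d) (-1)^i] makes the right side [2X (1 + z^2)^2], which cancels the [2X] on the
    left for either parity of [d]. *)
Lemma sum_alternating_qsquare (R : realType) (d : nat) : (2 < d)%N ->
  \sum_(i < d) (-1) ^+ i * (zeta R d ^+ i - zeta R d ^- i) ^+ 2 = 0.
Proof.
move=> hd; have z0 := zeta_neq0 R hd.
have := @sum_signed_qsquare _ (zeta R d) d (-1) z0.
rewrite (zetaXd R hd) sqrrN expr1n => /(_ erefl).
have := subrX1 (-1 : R[i]) d.
set X := \sum_(i < d) (-1) ^+ i; set B := \sum_(i < d) _ => -> h.
have nz : (1 + zeta R d ^+ 2) ^+ 2 != 0.
  by rewrite expf_neq0 // addrC -[1]opprK subr_eq0 zeta_sqr_neqN1.
by apply: (mulfI nz); rewrite mulr0; move/eqP: h; rewrite -subr_eq0 => /eqP <-; ring.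
Qed.

(** Lets the geometric sums over ['I_d] compute sums over simple objects: the extra index 0
    contributes [[0]^2 = 0]. *)
Lemma sum_irr_sl2 (V : nmodType) (d : nat) (F : nat -> V) :
  F 0%N = 0 -> \sum_(X : irr_sl2 d) F (idx X) = \sum_(i < d) F i.
Proof.
move=> F0; rewrite [RHS](bigID (fun i : 'I_d => (0 < i)%N)) /= [X in _ + X]big1.
  by rewrite addr0 (big_sub _ (fun i : 'I_d => F i)).
by move=> i; rewrite -eqn0Ngt => /eqP ->.
Qed.

Lemma dimC0E (R : realType) (d : nat) (hd : (2 < d)%N) :
  dimC0 R hd = 2 * (- d%:R / (zeta R d - (zeta R d)^-1) ^+ 2) ^+ 2.
Proof.
set z := zeta R d; set s := z - z^-1.
pose f (i : nat) := (z ^+ i - z ^- i) ^+ 2 / s ^+ 2.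
have f0 : f 0%N = 0 by rewrite /f expr0 invr1 subrr expr0n mul0r.
have s1 : s != 0 by have := @zetaB_neq0 R d 1 ltac:(lia); rewrite expr1.
have A : \sum_(X : irr_sl2 d) f (idx X) = - (2 * d)%:R / s ^+ 2.
  by rewrite sum_irr_sl2 // -mulr_suml sum_qsquare.
have B : \sum_(X : irr_sl2 d) (-1) ^+ idx X * f (idx X) = 0.
  rewrite (@sum_irr_sl2 _ d (fun i => (-1) ^+ i * f i)) ?f0 ?mulr0 //.
  under eq_bigr do rewrite mulrA.
  by rewrite -mulr_suml sum_alternating_qsquare // mul0r.
have two0 : (2 : R[i]) != 0 by rewrite pnatr_eq0.
apply: (mulfI two0); transitivity
  ((\sum_(X : irr_sl2 d) f (idx X)) * (\sum_(X : irr_sl2 d) f (idx X))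
   + (\sum_(X : irr_sl2 d) (-1) ^+ idx X * f (idx X))
     * (\sum_(X : irr_sl2 d) (-1) ^+ idx X * f (idx X))); last first.
  by rewrite A B natrM; field.
rewrite !big_distrlr /= !pair_big -big_split /= /dimC0 mulr_sumr big_mkcond /=.
apply: eq_bigr => X _; rewrite deg0E /dim_obj /=.
have -> : idx (V (one_lt hd)) = 1%N by [].
rewrite !mul1n [(-1) ^+ _ * _ * _]mulrACA -exprD -signr_odd -/z -/s.
have -> : (idx X.1 == idx X.2 %[mod 2])%N = ~~ odd (idx X.1 + idx X.2) by lia.
rewrite /f; move: (_ - z ^- idx X.1) (_ - z ^- idx X.2) => x y.
case: odd => /=; first by rewrite expr1; ring.
by rewrite expr0 !exprMn !exprVn; ring.
Qed.

(** [zeta - zeta^-1 = 2i sin(pi/d)] is purely imaginary. This sign makes [-d / (zeta - zeta^-1)^2]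
    the root selected by [sqrtC]. *)
Lemma zetaB_sqr_le0 (R : realType) (d : nat) :
  (zeta R d - (zeta R d)^-1) ^+ 2 <= 0.
Proof.
rewrite /zeta expiV /expi cosN sinN; set c := cos _; set s := sin _.
have -> : (c +i* s - c +i* (- s))%C ^+ 2 = - ((2 * s) ^+ 2)%:C%C.
  by rewrite expr2; simpc; apply/eqP; rewrite eq_complex /=; apply/andP; split;
    apply/eqP; ring.
by rewrite oppr_le0 lecR sqr_ge0.
Qed.

Lemma sqrtC_half_dimC0 (R : realType) (d : nat) (hd : (2 < d)%N) :
  sqrtC (dimC0 R hd / 2%:R) = - d%:R / (zeta R d - (zeta R d)^-1) ^+ 2.
Proof.
rewrite dimC0E mulrAC mulfV ?pnatr_eq0 // mul1r sqrCK //.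
by rewrite mulr_le0 ?oppr_le0 ?ler0n // invr_le0 zetaB_sqr_le0.
Qed.

Lemma zeta_half_sqr (R : realType) (d : nat) : (2 < d)%N ->
  zeta_half R d ^+ 2 = zeta R d.
Proof.
move=> hd; rewrite /zeta_half /zeta expiMn natrM; congr expi; field.
by rewrite pnatr_eq0; lia.
Qed.

(* [x = zeta^(am)], [y = zeta^(il)], [t = zeta^(jk)] and [s = zeta - zeta^-1]. *)
Lemma crossed_entry (F : fieldType) (n s x y t : F) :
    n != 0 -> s != 0 -> x != 0 -> y != 0 -> t != 0 ->
  (x - x^-1) / s * ((y * t * x - (y * t * x)^-1) / s) / (- n / s ^+ 2)
  = n^-1 * (y * t + (y * t)^-1 - x * (y * t * x) - (x * (y * t * x))^-1).
Proof.
by move=> n0 s0 x0 y0 t0; field; rewrite oppr_eq0 n0 s0 x0 y0 t0.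
Qed.

Lemma Psi_exponents (i j k l : nat) : (i <= j)%N -> (k <= l)%N ->
    odd k -> odd l ->
  [/\ (i * k + j * l = (j - i) * (l - k)./2 + (i + j) * (k + l)./2)%N,
      (i * l + j * k + (j - i) * (l - k)./2 = (i + j) * (k + l)./2)%N
    & ((k + l)./2 ^ 2 = (l - k)./2 ^ 2 + k * l)%N].
Proof.
(* Substituting [j = i + a] and [l = k + 2m] removes the truncated differences and the halves,
   leaving polynomial identities. *)
move=> /subnKC <- lekl ok ol; set a := (j - i)%N.
have el : l = (k + 2 * (l - k)./2)%N by lia.
set m := (l - k)./2 in el *; rewrite {}el {ol lekl}.
have -> : (k + (k + 2 * m))./2 = (k + m)%N by lia.
by rewrite addKn; split; rewrite -?mulnn; lia.
Qed.

Theorem theorem3p5 (R : realType) (d : nat) (hd : (2 < d)%N) :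
  (forall (p : idxI d) (q : idxJ d),
      tS01 R hd (Psi0 p) (Psi1 q) = fourier R p q)
  /\ (forall q : idxJ d,
      twist (CC R hd) (val (Psi1 q)) ^- 2 = frobenius R q).
Proof.
have z0 := zeta_neq0 R hd.
split=> [[[i j] hp] [[k l] hq]|[[k l] hq]].
  rewrite /tS01 sqrtC_half_dimC0 /S01 /fourier /= /idx /=.
  have s1 : zeta R d - (zeta R d)^-1 != 0.
    by have := @zetaB_neq0 R d 1 ltac:(lia); rewrite expr1.
  have d0 : d%:R != 0 :> R[i] by rewrite pnatr_eq0; lia.
  move: hp hq; rewrite /in_I /in_J /= => hp hq.
  (* The reverse rewrite replaces [bn] by [il + jk + am], so only powers with exponents [am], [il],
     [jk] remain, as in [crossed_entry]. *)
  have [||||-> <- _] := @Psi_exponents i j k l; [lia..|].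
  rewrite !exprD.
  by apply: crossed_entry => //; rewrite expf_neq0.
rewrite /frobenius /= /idx /=; move: hq; rewrite /in_J /= => hq.
set m := (l - k)./2; set n := (k + l)./2.
have zh0 : zeta_half R d != 0.
  by apply: contraNneq z0 => h; rewrite -zeta_half_sqr // h expr0n.
(* Only [n^2 = m^2 + kl] matters here, hence [i = j = 0]. Since [k < l] are odd, [m > 0] and
   [m^2 - 1] is not truncated. *)
have e : (n ^ 2 - 1 = m ^ 2 - 1 + k * l)%N.
  have [//||||_ _ ->] := @Psi_exponents 0 0 k l; [lia..|].
  by rewrite addnBAC // expn_gt0 /m; lia.
(* The twist is [zeta_half^(-kl)], so its power [-2] is [zeta_half^(2kl)]. *)
rewrite e exprD -exprVn invf_div mulrAC divff ?expf_neq0 // mul1r.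
by rewrite exprAC zeta_half_sqr.
Qed.
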